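(* Let $A\in\mathbb{C}^{n\times n}$, let $\mathbf{v}\in\mathbb{C}^n$ with $\|\mathbf{v}\|=1$, and let $V_m$, $H_m$, $h_{m+1,m}$ be the quantities produced by $m$ steps of the Arnoldi algorithm applied to $A$ and $\mathbf{v}$. Suppose the field of values $W(A)$ is contained in a closed region $E$ whose boundary is a horizontal ellipse with semi-axes $a\ge b>0$ and center $c=c_1+ic_2$, $c_1,c_2\in\mathbb{R}$. Set $r_m=|h_{m+1,m}\,\mathbf{e}_m^T e^{-H_m}\mathbf{e}_1|$. Then, for $m>b+1$, $$|r_m|\le h_{m+1,m}\,2e^{-c_1}\,p(m)\left(\frac{e^{q(m-1)}(a+b)}{m-1+\sqrt{(m-1)^2+(a^2-b^2)}}\right)^{m-1},$$ where $$q(m-1)=1+\frac{a^2-b^2}{(m-1)^2+(m-1)\sqrt{(m-1)^2+(a^2-b^2)}},$$ $$p(m)=\frac{m-1+\sqrt{(m-1)^2+(a^2-b^2)}}{m-1+\sqrt{(m-1)^2+(a^2-b^2)}-(a+b)}.$$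
   Context: The field of values is $W(A)=\{\mathbf{x}^*A\mathbf{x} : \mathbf{x}\in\mathbb{C}^n,\ \|\mathbf{x}\|=1\}$ (Euclidean norm). The $m$-th step of the Arnoldi algorithm yields an $n\times m$ matrix $V_m=[\mathbf{v}_1,\dots,\mathbf{v}_m]$ with $\mathbf{v}_1=\mathbf{v}$ whose columns form an orthonormal basis of the Krylov subspace $\mathrm{span}\{\mathbf{v},A\mathbf{v},\dots,A^{m-1}\mathbf{v}\}$, a further vector $\mathbf{v}_{m+1}$ such that $[V_m,\mathbf{v}_{m+1}]$ has orthonormal columns, an $m\times m$ upper Hessenberg matrix $H_m=V_m^*AV_m$ and a scalar $h_{m+1,m}\ge 0$ with $AV_m=V_mH_m+h_{m+1,m}\mathbf{v}_{m+1}\mathbf{e}_m^T$. Here $\mathbf{e}_j$ is the $j$-th canonical basis vector of $\mathbb{C}^m$. A horizontal ellipse is one whose semi-axis of length $a$ is parallel to the real axis and whose semi-axis of length $b$ is parallel to the imaginary axis. The quantity $r_m$ is the residual norm at $t=1$ associated with the Arnoldi approximation $V_me^{-tH_m}\mathbf{e}_1$ of $e^{-tA}\mathbf{v}$. *)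

(* Defs.v *)
From HB Require Import structures.
From mathcomp Require Import all_boot all_order all_algebra.
From mathcomp Require Import complex.
From mathcomp Require Import all_classical all_reals all_analysis.

Set Implicit Arguments.
Unset Strict Implicit.
Unset Printing Implicit Defensive.

Import Order.TTheory GRing.Theory Num.Theory.
Import numFieldNormedType.Exports.

Local Open Scope ring_scope.
Local Open Scope complex_scope.
Local Open Scope sesquilinear_scope.
Local Open Scope classical_set_scope.

Section ComplexMatrices.
Variable R : realType.
Local Notation C := R[i].

(* The modulus as a real number: the ring norm `|z| of R[i] lives in R[i]. *)
Definition cmod (z : C) : R := Normc.normc z.

Definition enorm (n : nat) (x : 'cV[C]_n) : R :=
  Num.sqrt (\sum_(i < n) cmod (x i ord0) ^+ 2).

Definition orthonormal_cols (n m : nat) (M : 'M[C]_(n, m)) : Prop :=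
  M ^t* *m M = 1%:M.

Definition field_of_values (n : nat) (A : 'M[C]_n) : set C :=
  [set z | exists x : 'cV[C]_n,
     enorm x = 1 /\ z = (x ^t* *m A *m x) ord0 ord0].

(* The j-th canonical basis vector, with j counted from 1. *)
Definition ebasis (m j : nat) : 'cV[C]_m := \col_(i < m) (i.+1 == j)%:R.

(* The limit is taken over C^o, i.e. C with the topology of its modulus: the
   libraries put no topology on R[i] itself. *)
Definition expmx (m : nat) (M : 'M[C]_m) : 'M[C]_m :=
  limn (fun N => (\sum_(0 <= k < N) (k`!%:R^-1 : C) *: M ^+ k) : 'M[C^o]_m).

Definition krylov (n : nat) (A : 'M[C]_n) (v : 'cV[C]_n) (m : nat) :
    {vspace 'cV[C]_n} :=
  <<[seq A ^+ j *m v | j <- iota 0 m]>>%VS.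

Definition upper_hessenberg (m : nat) (H : 'M[C]_m) : Prop :=
  forall i j : 'I_m, (j.+1 < i)%N -> H i j = 0.

(* w is v_(m+1) and h is h_(m+1,m), a real number. *)
Record arnoldi (n m : nat) (A : 'M[C]_n) (v : 'cV[C]_n)
    (V : 'M[C]_(n, m)) (w : 'cV[C]_n) (H : 'M[C]_m) (h : R) : Prop := Arnoldi {
  arnoldi_start : V *m ebasis m 1 = v;
  arnoldi_basis : basis_of (krylov A v m) [seq col j V | j : 'I_m];
  arnoldi_orthonormal : orthonormal_cols (row_mx V w);
  arnoldi_hessenberg : upper_hessenberg H;
  arnoldi_compression : H = V ^t* *m A *m V;
  arnoldi_h_ge0 : 0 <= h;
  arnoldi_relation :
    A *m V = V *m H + h%:C *: (w *m (ebasis m m)^T) }.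

(* The closed region bounded by the horizontal ellipse with centre c and
   semi-axes a (real direction) and b (imaginary direction). *)
Definition ellipse_region (a b : R) (c : C) : set C :=
  [set z | ((complex.Re z - complex.Re c) / a) ^+ 2
         + ((complex.Im z - complex.Im c) / b) ^+ 2 <= 1].

Definition residual (m : nat) (H : 'M[C]_m) (h : R) : R :=
  cmod (h%:C * ((ebasis m m)^T *m expmx (- H) *m ebasis m 1) ord0 ord0).

End ComplexMatrices.

Section BoundFactors.
Variable R : realType.
Implicit Types a b x : R.

Definition sqrt_term a b x : R := Num.sqrt (x ^+ 2 + (a ^+ 2 - b ^+ 2)).

Definition qfun a b x : R :=
  1 + (a ^+ 2 - b ^+ 2) / (x ^+ 2 + x * sqrt_term a b x).

(* The argument is the real number m itself. *)
Definition pfun a b x : R :=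
  (x - 1 + sqrt_term a b (x - 1)) / (x - 1 + sqrt_term a b (x - 1) - (a + b)).

End BoundFactors.

(* Main.v *)
Require Import Defs.
From HB Require Import structures.
From mathcomp Require Import all_boot all_order all_algebra.
From mathcomp Require Import complex.
From mathcomp Require Import all_classical all_reals all_analysis.
From mathcomp Require Import ring lra.

Set Implicit Arguments.
Unset Strict Implicit.
Unset Printing Implicit Defensive.

Import Order.TTheory GRing.Theory Num.Theory.
Import numFieldNormedType.Exports.

(** Put X = H - c and M = m - 1. The field of values of X lies in the centred
    ellipse with semi-axes a = al + be and b = al - be, and up to a factor
    al^k the Faber polynomials of this ellipse are the Dickson polynomials
    D_k, determined by D_k(u + v) = u^k + v^k whenever u v = al be.

    The main point is that |y* D_k(X) x| <= 2 al^k for unit vectors x and y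
    ([dickson_mx_bound]). It follows by polarization from [dickson_mx_range]:
    if W(X) lies in the ellipse with parameters al, be, then W(D_k(X)) lies
    in the bounding box of the ellipse with parameters al^k, be^k. This is
    proved like the power inequality for the numerical radius: the quadratic
    al - z t + be t^2, multiplied over the k-th roots t of a unimodular s,
    gives the same quadratic for al^k, be^k, D_k(z) and s, and a partial
    fraction identity over these roots turns the half-plane condition on
    W(X) at each t into the half-plane condition on W(D_k(X)) at s.

    As X is upper Hessenberg, the bottom left entry of D_k(X) is 0 for k < M.
    Expanding X^p in Dickson polynomials therefore leaves only terms of index
    at least M, and weighting them by tau^(k - M) with tau >= 1 gives
    |(X^p)_(m,1)| <= 2 tau^-M (al tau + be / tau)^p ([power_corner_bound]).
    Summing against 1/p! and factoring e^(-c) out of e^(-H)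
    ([exp_corner_bound]), one gets for |(e^(-H))_(m,1)| the bound
    2 e^(-c1) tau^-M e^(al tau + be / tau).

    With s = sqrt (M^2 + a^2 - b^2), the optimal choice is
    tau = (M + s) / (a + b), for which al tau + be / tau = s = M q(M). The
    condition M > b makes tau > 1, and p(m) = tau / (tau - 1) is at least 1,
    so this bound implies the stated one. *)

Local Open Scope ring_scope.

(** * Dickson polynomials and products over roots of unity *)

(** A polynomial is the Lagrange interpolant of its values at 0, 1, 2, ... *)
Lemma poly_ext {K : numFieldType} (p q : {poly K}) :
  (forall x, p.[x] = q.[x]) -> p = q.
Proof.
move=> pq; pose n := (maxn (size p) (size q)).+1.
have natI : injective (fun i : nat => i%:R : K).
  by move=> i j /eqP; rewrite eqr_nat => /eqP.
rewrite (lagrange_gen (ltn0Sn _ : (0 < n)%N) natI (p := p)) ?leqW ?leq_maxl //.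
rewrite (lagrange_gen (ltn0Sn _ : (0 < n)%N) natI (p := q)) ?leqW ?leq_maxr //.
by apply: eq_bigr => i _; rewrite pq.
Qed.

Lemma deriv_prod {K : comNzRingType} {I : finType} (F : I -> {poly K}) :
  (\prod_i F i)^`() = \sum_i (F i)^`() * \prod_(j | j != i) F j.
Proof.
have := index_enum_uniq I; elim: (index_enum I) => [|x r IH] /=.
  by move=> _; rewrite !big_nil derivC.
case/andP=> xr ur; rewrite !big_cons eqxx derivM (IH ur); congr (_ * _ + _).
  rewrite [RHS]big_seq_cond [LHS]big_seq_cond; apply: eq_bigl => j /=.
  by case: eqP => [->|_]; rewrite ?(negPf xr) ?andbT.
rewrite big_distrr /= big_seq_cond [RHS]big_seq_cond; apply: eq_bigr => i /andP[ir _].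
have xi : x != i by apply: contraNneq xr => ->.
by rewrite big_cons xi mulrCA.
Qed.

(** The Dickson polynomials of the first kind with parameter [d], that is
    rescaled Chebyshev polynomials. Division by al^k turns those of parameter
    al * be into the Faber polynomials of an ellipse for k > 0; the value 2
    at index 0 keeps the identity [horner_dickson] uniform. *)
Fixpoint dickson {K : comNzRingType} (d : K) (k : nat) : {poly K} :=
  if k is k1.+1 then
    if k1 is k2.+1 then 'X * dickson d k1 - d *: dickson d k2 else 'X
  else 2.

Lemma dicksonSS {K : comNzRingType} (d : K) k :
  dickson d k.+2 = 'X * dickson d k.+1 - d *: dickson d k.
Proof. by []. Qed.

Lemma horner_dickson {K : comNzRingType} (u v : K) k :
  (dickson (u * v) k).[u + v] = u ^+ k + v ^+ k.
Proof.
elim: k {-2}k (leqnn k) => [|n IH] [|[|k]] // kn;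
  rewrite ?dicksonSS !hornerE ?expr0 ?expr1 //.
by rewrite (IH k.+1) ?(IH k (ltnW kn)) // !exprS; ring.
Qed.

Section RootProducts.
Variables (K : numClosedFieldType) (N : nat) (s : K) (t : 'I_N -> K).
Hypothesis N_gt0 : (0 < N)%N.
Hypothesis Xs_prod : 'X^N - s%:P = \prod_i ('X - (t i)%:P).

(** The factorization of 'X^N - s, made homogeneous. *)
Lemma prod_sub_mul p q : \prod_i (p - q * t i) = p ^+ N - s * q ^+ N.
Proof.
have [->|q0] := eqVneq q 0.
  rewrite expr0n eqn0Ngt N_gt0 mulr0 subr0.
  by under eq_bigr do rewrite mul0r subr0; rewrite prodr_const card_ord.
have /(congr1 (fun f : {poly K} => f.[p / q])) := Xs_prod.
rewrite !hornerE horner_prod => /(congr1 ( *%R (q ^+ N))).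
rewrite mulrBr -exprMn mulrC divfK // [q ^+ N * s]mulrC => ->.
rewrite -[N in q ^+ N]card_ord -prodr_const -big_split.
by apply: eq_bigr => i _; rewrite !hornerE /=; field.
Qed.

Variables (al be : K).
Hypothesis al0 : al != 0.

(** With z = u + v and u v = al be, al times each factor splits as
    (al - u l t) (al - v l t), and both products are given by
    [prod_sub_mul]. The scaling [l] is kept in order to differentiate in it. *)
Lemma prod_quadratic_scaled z l :
  \prod_i (al - z * l * t i + be * (l * t i) ^+ 2) =
  al ^+ N - s * (dickson (al * be) N).[z] * l ^+ N + be ^+ N * s ^+ 2 * l ^+ (2 * N).
Proof.
(* u and v are the roots of T^2 - z T + al be. *)
pose w := sqrtC (z ^+ 2 - 4 * (al * be)).
pose u := (z + w) / 2; pose v := (z - w) / 2.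
have uvD : u + v = z by rewrite /u /v; field.
have uvM : u * v = al * be.
  have : w ^+ 2 = z ^+ 2 - 4 * (al * be) by rewrite sqrtCK.
  by rewrite /u /v => w2; have -> : (z + w) / 2 * ((z - w) / 2) = (z ^+ 2 - w ^+ 2) / 4;
     [field | rewrite w2; field].
clearbody u v; rewrite -uvM -uvD horner_dickson.
have alN : al ^+ N != 0 by rewrite expf_neq0.
apply: (mulfI alN).
transitivity ((\prod_i (al - (u * l) * t i)) * \prod_i (al - (v * l) * t i)).
  rewrite -[X in al ^+ X * _]card_ord -prodr_const -!big_split.
  apply: eq_bigr => i _ /=.
  have -> : al * (al - (u + v) * l * t i + be * (l * t i) ^+ 2) =
    al ^+ 2 - (u + v) * l * t i * al + (al * be) * (l * t i) ^+ 2 by ring.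
  by rewrite -uvM; ring.
rewrite !prod_sub_mul !exprMn.
have uvN : u ^+ N * v ^+ N = al ^+ N * be ^+ N by rewrite -!exprMn uvM.
rewrite mulnC exprM.
set L := l ^+ N; set D := u ^+ N + v ^+ N.
have -> : al ^+ N * (al ^+ N - s * D * L + be ^+ N * s ^+ 2 * L ^+ 2) =
  al ^+ N * (al ^+ N - s * D * L) + al ^+ N * be ^+ N * s ^+ 2 * L ^+ 2 by ring.
by rewrite -uvN /D; ring.
Qed.

Lemma prod_quadratic :
  \prod_i ((al + be * t i ^+ 2)%:P - t i *: 'X) =
  (al ^+ N + be ^+ N * s ^+ 2)%:P - s *: dickson (al * be) N.
Proof.
apply: poly_ext => z; rewrite horner_prod !hornerE /=.
have := prod_quadratic_scaled z 1; rewrite !expr1n !mulr1 => e.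
transitivity (al ^+ N - s * (dickson (al * be) N).[z] + be ^+ N * s ^+ 2); last by ring.
by rewrite -e; apply: eq_bigr => i _; rewrite !hornerE /=; ring.
Qed.

(** The partial fraction expansion of N (al^N - be^N s^2) / P, cleared of
    denominators, where P is the product of the factors al - z t + be t^2. For
    P(l) the product scaled by l, Euler's operator gives
    N P(1) - P'(1) = N (al^N - be^N s^2) on one side, and on the other the sum
    over the roots of (al - be t^2) times the product of the other factors. *)
Lemma sum_prod_quadratic :
  \sum_i (al - be * t i ^+ 2) *:
    \prod_(j | j != i) ((al + be * t j ^+ 2)%:P - t j *: 'X) =
  (N%:R * (al ^+ N - be ^+ N * s ^+ 2))%:P.
Proof.
apply: poly_ext => z.
pose F i : {poly K} := al%:P - (z * t i) *: 'X + (be * t i ^+ 2) *: 'X^2.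
pose P : {poly K} := (al ^+ N)%:P - (s * (dickson (al * be) N).[z]) *: 'X^N
   + (be ^+ N * s ^+ 2) *: 'X^(2 * N).
have FP : \prod_i F i = P.
  apply: poly_ext => l; rewrite horner_prod.
  transitivity (\prod_i (al - z * l * t i + be * (l * t i) ^+ 2)).
    by apply: eq_bigr => i _; rewrite /F !hornerE /=; ring.
  by rewrite prod_quadratic_scaled /P !hornerE /=; ring.
have F1 i : (F i).[1] = ((al + be * t i ^+ 2)%:P - t i *: 'X).[z].
    by rewrite /F !hornerE /=; ring.
have P1 : N%:R * P.[1] - P^`().[1] = N%:R * (al ^+ N - be ^+ N * s ^+ 2).
  rewrite /P derivD derivB derivC !derivZ !derivXn.
  rewrite !(hornerD, hornerN, hornerZ, hornerC, hornerXn, hornerMn) !expr1n natrM.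
  by ring.
rewrite hornerC -P1 -FP deriv_prod !horner_sum mulr_natl.
rewrite -[X in _ *+ X](card_ord N) -sumr_const.
rewrite -sumrB; apply: eq_bigr => i _.
rewrite hornerZ hornerM !horner_prod [X in _ = X - _](bigD1 i) //= -mulrBl.
under [in RHS]eq_bigr do rewrite F1.
by congr (_ * _); rewrite /F !poly.derivE !hornerE /=; ring.
Qed.

End RootProducts.

(** * Complex numbers, inner product and elliptic ranges *)

Local Open Scope complex_scope.
Local Open Scope sesquilinear_scope.
Local Notation Re := complex.Re.
Local Notation Im := complex.Im.

Section ComplexNumbers.
Variable R : realType.
Implicit Types (x y z : R[i]) (r : R).

Lemma conj_conjc z : (Num.conj z = z^*)%C.
Proof. by []. Qed.

Lemma cReD x y : Re (x + y) = Re x + Re y.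
Proof. by case: x y => ? ? []. Qed.

Lemma cImD x y : Im (x + y) = Im x + Im y.
Proof. by case: x y => ? ? []. Qed.

Lemma cReM x y : Re (x * y) = Re x * Re y - Im x * Im y.
Proof. by case: x y => ? ? []. Qed.

Lemma cImM x y : Im (x * y) = Re x * Im y + Im x * Re y.
Proof. by case: x y => ? ? []. Qed.

Lemma cReN x : Re (- x) = - Re x.
Proof. by case: x. Qed.

Lemma cImN x : Im (- x) = - Im x.
Proof. by case: x. Qed.

Lemma cRe_conj x : Re (Num.conj x) = Re x.
Proof. by case: x. Qed.

Lemma cIm_conj x : Im (Num.conj x) = - Im x.
Proof. by case: x. Qed.

Lemma cRe_sum I (r : seq I) (F : I -> R[i]) :
  Re (\sum_(i <- r) F i) = \sum_(i <- r) Re (F i).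
Proof. exact: (big_morph _ cReD (erefl _)). Qed.

Lemma cIm_sum I (r : seq I) (F : I -> R[i]) :
  Im (\sum_(i <- r) F i) = \sum_(i <- r) Im (F i).
Proof. exact: (big_morph _ cImD (erefl _)). Qed.

Lemma cmod_ge0 x : 0 <= cmod x.
Proof. by case: x => u v; rewrite /cmod /= sqrtr_ge0. Qed.

Lemma sqr_cmod x : cmod x ^+ 2 = Re x ^+ 2 + Im x ^+ 2.
Proof. by case: x => u v; rewrite /cmod /= sqr_sqrtr // addr_ge0 ?sqr_ge0. Qed.

Lemma cmodE x : (cmod x)%:C = `|x|.
Proof. by case: x. Qed.

Lemma cmodM x y : cmod (x * y) = cmod x * cmod y.
Proof. exact: Normc.normcM. Qed.

Lemma cmodX x n : cmod (x ^+ n) = cmod x ^+ n.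
Proof. by apply: complexI; rewrite rmorphXn /= !cmodE normrX. Qed.

Lemma cmodV x : cmod x^-1 = (cmod x)^-1.
Proof. exact: Normc.normcV. Qed.

Lemma cmodN x : cmod (- x) = cmod x.
Proof. exact: normcN. Qed.

Lemma cmodD x y : cmod (x + y) <= cmod x + cmod y.
Proof. exact: le_normcD. Qed.

Lemma cmod_real r : cmod r%:C = `|r|.
Proof. by rewrite /cmod /= expr0n addr0 sqrtr_sqr. Qed.

Lemma cmod_sum I (r : seq I) (P : pred I) (F : I -> R[i]) :
  cmod (\sum_(i <- r | P i) F i) <= \sum_(i <- r | P i) cmod (F i).
Proof.
elim/big_rec2: _ => [|i y x _ xy]; first by rewrite cmod_real normr0.
by apply: le_trans (cmodD _ _) _; rewrite lerD2l.
Qed.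

Lemma cmod_nat (k : nat) : cmod (k%:R : R[i]) = k%:R.
Proof. by rewrite -(rmorph_nat (real_complex R)) cmod_real ger0_norm // ler0n. Qed.

Lemma cmod0 : cmod (0 : R[i]) = 0.
Proof. exact: (cmod_nat 0). Qed.

End ComplexNumbers.

Section InnerProduct.
Variables (R : realType) (n : nat).
Implicit Types (x y z : 'cV[R[i]]_n) (c : R[i]).

Definition dot x y : R[i] := (x ^t* *m y) ord0 ord0.

Lemma dotDr x y z : dot x (y + z) = dot x y + dot x z.
Proof. by rewrite /dot mulmxDr mxE. Qed.

Lemma dotZr c x y : dot x (c *: y) = c * dot x y.
Proof. by rewrite /dot -scalemxAr mxE. Qed.

Lemma dotDl x y z : dot (x + y) z = dot x z + dot y z.
Proof. by rewrite /dot linearD /= map_mxD mulmxDl mxE. Qed.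

Lemma dotZl c x y : dot (c *: x) y = Num.conj c * dot x y.
Proof. by rewrite /dot linearZ /= map_mxZ -scalemxAl mxE. Qed.

Lemma dot_suml (I : finType) (F : I -> 'cV[R[i]]_n) y :
  dot (\sum_i F i) y = \sum_i dot (F i) y.
Proof. 
apply: (big_morph (dot ^~ y)) => [u w|]; first exact: dotDl.
by rewrite /dot trmx0 map_mx0 mul0mx mxE.
Qed.

Lemma dotxx x : dot x x = (enorm x ^+ 2)%:C.
Proof.
rewrite /dot /enorm sqr_sqrtr; last by apply: sumr_ge0 => i _; rewrite sqr_ge0.
rewrite mxE rmorph_sum /=; apply: eq_bigr => i _; rewrite !mxE.
by rewrite rmorphXn /= cmodE -normCKC.
Qed.

End InnerProduct.

Section EllipticRange.
Variables (R : realType) (n : nat).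
Local Notation C := R[i].

(** The support function of the ellipse in the direction (p, - q) rescaled by
    the axes, by the Cauchy-Schwarz inequality. *)
Lemma ellipse_support {a b p q u w s : R} : 0 < a -> 0 < b -> 0 <= s ->
  p ^+ 2 + q ^+ 2 = 1 -> (u / a) ^+ 2 + (w / b) ^+ 2 <= s ^+ 2 ->
  b * p * u - a * q * w <= a * b * s.
Proof.
move=> a0 b0 s0 pq uws; set U := u / a in uws; set W := w / b in uws.
have -> : u = a * U by rewrite /U mulrC divfK ?gt_eqF.
have -> : w = b * W by rewrite /W mulrC divfK ?gt_eqF.
have -> : b * p * (a * U) - a * q * (b * W) = a * b * (p * U - q * W) by ring.
rewrite ler_pM2l ?mulr_gt0 // (le_trans (ler_norm _)) //.
rewrite -(ler_pXn2r (n := 2)) ?nnegrE // real_normK ?num_real //.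
apply: le_trans uws; rewrite -[leRHS]mul1r -pq -subr_ge0.
have -> : (p ^+ 2 + q ^+ 2) * (U ^+ 2 + W ^+ 2) - (p * U - q * W) ^+ 2
  = (p * W + q * U) ^+ 2 by ring.
exact: sqr_ge0.
Qed.

(** The field of values of [Y] lies in the centred ellipse with semi-axes [a]
    and [b]; the homogeneous form applies to every vector and has no division
    by its norm. *)
Definition elliptic_range (a b : R) (Y : 'M[C]_n) : Prop :=
  forall x : 'cV[C]_n, (Re (dot x (Y *m x)) / a) ^+ 2 +
    (Im (dot x (Y *m x)) / b) ^+ 2 <= (Re (dot x x)) ^+ 2.

(** For |t| = 1 the values of Y lie on one side of the tangent to the ellipse
    at its point al / t + be t, the zero of al - z t + be t^2; on that side
    the quotient (al - be t^2) / (al - z t + be t^2) has nonnegative real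
    part. *)
Lemma elliptic_range_support (al be : R) (Y : 'M[C]_n) (t : C) x :
  0 < al + be -> 0 < al - be -> elliptic_range (al + be) (al - be) Y ->
  cmod t = 1 ->
  0 <= Re (Num.conj (al%:C - be%:C * t ^+ 2) *
           dot x (((al%:C + be%:C * t ^+ 2)%:M - t *: Y) *m x)).
Proof.
move=> a0 b0 /(_ x) Yx t1.
have pq : Re t ^+ 2 + Im t ^+ 2 = 1 by rewrite -sqr_cmod t1 expr1n.
have s0 : 0 <= Re (dot x x) by rewrite dotxx /= sqr_ge0.
have := ellipse_support a0 b0 s0 pq Yx; rewrite -subr_ge0 => le0.
rewrite mulmxBl mul_scalar_mx -scalemxAl -[- (t *: _)]scaleN1r dotDr !dotZr.
have tt : t * Num.conj t = 1 by rewrite -normCK -cmodE t1 expr1n.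
rewrite dotxx /= in le0 *.
set Q := dot x (Y *m x) in le0 *; set s := enorm x ^+ 2 in le0 *.
rewrite rmorphB rmorphM rmorphXn /=.
have -> : Num.conj al%:C = al%:C by rewrite conj_conjc conjc_real.
have -> : Num.conj be%:C = be%:C by rewrite conj_conjc conjc_real.
set u := Num.conj t in tt *.
have -> : (al%:C - be%:C * u ^+ 2) * ((al%:C + be%:C * t ^+ 2) * s%:C + -1 * (t * Q)) =
  (al%:C ^+ 2 - be%:C ^+ 2 * (t * u) ^+ 2) * s%:C +
  al%:C * be%:C * (t ^+ 2 - u ^+ 2) * s%:C
  - (al%:C * t - be%:C * u * (t * u)) * Q by ring.
rewrite tt /u; apply: le_trans le0 _; rewrite le_eqVlt; apply/orP; left; apply/eqP.
case: t {t1 tt pq u} => p q; case: Q => v w /=; ring.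
Qed.

End EllipticRange.

(** * The range of a Dickson polynomial of a matrix *)

Lemma XnsubC_split (K : closedFieldType) (N : nat) (s : K) : (0 < N)%N ->
  exists t : 'I_N -> K, 'X^N - s%:P = \prod_i ('X - (t i)%:P).
Proof.
move=> N0; have [r] := closed_field_poly_normal ('X^N - s%:P).
rewrite lead_coefXnsubC // scale1r => er.
have := congr1 (size : {poly K} -> nat) er.
rewrite size_prod_XsubC size_XnsubC // => -[sr].
exists (fun i => r`_i); rewrite er sr.
by rewrite (big_nth 0) big_mkord.
Qed.

Section Dickson.
Variables (R : realType) (n : nat) (al be : R) (X : 'M[R[i]]_n.+1).
Local Notation C := R[i].
Hypotheses (be0 : 0 <= be) (albe : be < al).
Hypothesis rangeX : elliptic_range (al + be) (al - be) X.

Let al0 : 0 < al := le_lt_trans be0 albe.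

Definition dickson_mx (k : nat) : 'M[C]_n.+1 :=
  horner_mx X (dickson (al%:C * be%:C) k).

(** Let t_i be the roots of t^N = s, D_i the quadratic factor of t_i evaluated
    at X, and x_i the image of x under the product of the other factors. Then
    D_i x_i = G x does not depend on i, and by [sum_prod_quadratic] the
    vectors (al - be t_i^2) x_i sum to N (al^N - be^N s^2) x. Hence the claimed
    real part is the mean of the real parts of
    conj (al - be t_i^2) <x_i, D_i x_i>, which are nonnegative by
    [elliptic_range_support]. No factor has to be inverted. *)
Lemma dickson_mx_support N (s : C) (x : 'cV[C]_n.+1) : (0 < N)%N -> cmod s = 1 ->
  0 <= Re (Num.conj ((al ^+ N)%:C - (be ^+ N)%:C * s ^+ 2) *
     dot x ((((al ^+ N)%:C + (be ^+ N)%:C * s ^+ 2)%:M - s *: dickson_mx N) *m x)).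
Proof.
move=> N0 s1; have [t et] := XnsubC_split s N0.
have tN i : t i ^+ N = s.
  have : root ('X^N - s%:P) (t i).
    rewrite /root et horner_prod; apply/prodf_eq0; exists i => //.
    by rewrite !hornerE subrr.
  by rewrite /root !hornerE subr_eq0 => /eqP.
have t1 i : cmod (t i) = 1.
  have : cmod (t i) ^+ N = 1.
    apply: complexI; rewrite rmorphXn /= cmodE -normrX tN -cmodE s1 //.
  by move/eqP; rewrite pexpr_eq1 ?cmod_ge0 // => /eqP.
have alC : al%:C != 0.
  by rewrite -(rmorph0 (real_complex R)) (inj_eq (@complexI R)) gt_eqF.
pose D i : {poly C} := (al%:C + be%:C * t i ^+ 2)%:P - t i *: 'X.
pose G : 'M[C]_n.+1 := horner_mx X (\prod_i D i).
pose P i : 'M[C]_n.+1 := horner_mx X (\prod_(j | j != i) D j).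
have GE : G = ((al ^+ N)%:C + (be ^+ N)%:C * s ^+ 2)%:M - s *: dickson_mx N.
  rewrite /G (prod_quadratic N0 et be%:C alC) rmorphB /= horner_mx_C.
  by rewrite horner_mxZ !rmorphXn.
have DP i : horner_mx X (D i) *m P i = G.
  by rewrite /G (bigD1 i) //= rmorphM.
have sumP : \sum_i (al%:C - be%:C * t i ^+ 2) *: P i =
    (N%:R * ((al ^+ N)%:C - (be ^+ N)%:C * s ^+ 2))%:M.
  rewrite !rmorphXn /= -(horner_mx_C X).
  rewrite -(sum_prod_quadratic N0 et be%:C alC) rmorph_sum.
  by apply: eq_bigr => i _; rewrite /= horner_mxZ.
rewrite -GE.
rewrite -(pmulr_rge0 (x := N%:R)) ?ltr0n //.
set z := _ - _ * s ^+ 2 in sumP *.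
have -> : N%:R * Re (Num.conj z * dot x (G *m x)) =
    Re (dot ((\sum_i (al%:C - be%:C * t i ^+ 2) *: P i) *m x) (G *m x)).
  rewrite sumP mul_scalar_mx dotZl rmorphM /= conjC_nat -mulrA.
  have -> : N%:R = (N%:R)%:C :> C by rewrite rmorph_nat.
  by rewrite [RHS]cReM /= mul0r subr0.
rewrite mulmx_suml dot_suml cRe_sum; apply: sumr_ge0 => i _.
rewrite -scalemxAl dotZl -(DP i) -mulmxA.
have -> : horner_mx X (D i) = (al%:C + be%:C * t i ^+ 2)%:M - t i *: X.
  by rewrite /D rmorphB /= horner_mx_C horner_mxZ horner_mx_X.
apply: elliptic_range_support => //; rewrite ?subr_gt0 //.
exact: ltr_wpDr.
Qed.

(** The support inequality at s = 1, -1 bounds the real part, and at s = i, -i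
    the imaginary part. *)
Lemma dickson_mx_range N x : (0 < N)%N ->
  `|Re (dot x (dickson_mx N *m x))| <= (al ^+ N + be ^+ N) * enorm x ^+ 2 /\
  `|Im (dot x (dickson_mx N *m x))| <= (al ^+ N - be ^+ N) * enorm x ^+ 2.
Proof.
move=> N0; set Q := dot x (dickson_mx N *m x).
have albeN : be ^+ N < al ^+ N by rewrite ltrXn2r // -lt0n.
have beN0 : 0 <= be ^+ N by rewrite exprn_ge0.
have key (s : C) : cmod s = 1 ->
  0 <= Re (Num.conj ((al ^+ N)%:C - (be ^+ N)%:C * s ^+ 2) *
    (((al ^+ N)%:C + (be ^+ N)%:C * s ^+ 2) * (enorm x ^+ 2)%:C - s * Q)).
  move=> s1; have := dickson_mx_support x N0 s1.
  rewrite mulmxBl mul_scalar_mx -scalemxAl -[- (_ *: (_ *m _))]scaleNr.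
  by rewrite dotDr !dotZr dotxx mulNr.
have sg1 (e : bool) : cmod (Complex ((-1) ^+ e) 0 : C) = 1.
  by rewrite /cmod /= sqrr_sign expr0n addr0 sqrtr1.
have sg2 (e : bool) : cmod (Complex 0 ((-1) ^+ e) : C) = 1.
  by rewrite /cmod /= sqrr_sign expr0n add0r sqrtr1.
have k1 e := key _ (sg1 e); have k2 e := key _ (sg2 e).
clear key sg1 sg2.
move: (enorm x ^+ 2) (al ^+ N) (be ^+ N) Q albeN beN0 k1 k2.
move=> nn A B [u v] BA B0 k1 k2.
split.
- have := k1 false; have := k1 true; rewrite /= !expr0 !expr1 => h1 h2.
  have p : 0 < A - B by rewrite subr_gt0.
  rewrite ler_norml; apply/andP; split; rewrite -(ler_pM2l p); lra.
- have := k2 false; have := k2 true; rewrite /= !expr0 !expr1 => h1 h2.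
  have p : 0 < A + B by lra.
  rewrite ler_norml; apply/andP; split; rewrite -(ler_pM2l p); lra.
Qed.

End Dickson.

Lemma dot_add_scale (R : realType) n (Y : 'M[R[i]]_n) (c : R[i]) (x w : 'cV[R[i]]_n) :
  dot (x + c *: w) (Y *m (x + c *: w)) =
  dot x (Y *m x) + c * dot x (Y *m w) + Num.conj c * dot w (Y *m x)
    + Num.conj c * c * dot w (Y *m w).
Proof. by rewrite mulmxDr -scalemxAr dotDr !dotDl dotZr !dotZl dotZr; ring. Qed.

(** Polarization: 4 <w, Y x> is the sum over k < 4 of
    i^k <x + i^k w, Y (x + i^k w)>. In its real part the values k = 0, 2
    contribute real parts and k = 1, 3 imaginary parts; by the parallelogram
    law the norms add up to 4 in each pair. The vector w is y times the phase
    that makes the form real and nonnegative. *)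
Lemma dot_polar (R : realType) n (Y : 'M[R[i]]_n) (a b : R) (x y : 'cV[R[i]]_n) :
  0 <= a -> 0 <= b -> 
  (forall z, `|Re (dot z (Y *m z))| <= a * enorm z ^+ 2) ->
  (forall z, `|Im (dot z (Y *m z))| <= b * enorm z ^+ 2) ->
  enorm x = 1 -> enorm y = 1 -> cmod (dot y (Y *m x)) <= a + b.
Proof.
move=> a0 b0 Ya Yb x1 y1.
have sqE (z : 'cV[R[i]]_n) : enorm z ^+ 2 = Re (dot z z) by rewrite dotxx.
have half w : enorm w = 1 -> Re (dot w (Y *m x)) <= a + b.
  move=> w1.
  pose q c p11 p12 p21 p22 : R[i] :=
    p11 + c * p12 + Num.conj c * p21 + Num.conj c * c * p22.
  have nE c : enorm (x + c *: w) ^+ 2 = Re (q c 1%:C (dot x w) (dot w x) 1%:C).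
    have := dot_add_scale 1%:M c x w; rewrite !mul1mx sqE => ->.
    by rewrite (dotxx x) (dotxx w) x1 w1 expr1n.
  have Yac c : `|Re (q c (dot x (Y *m x)) (dot x (Y *m w))
        (dot w (Y *m x)) (dot w (Y *m w)))|
      <= a * Re (q c 1%:C (dot x w) (dot w x) 1%:C).
    by have := Ya (x + c *: w); rewrite nE dot_add_scale.
  have Ybc c : `|Im (q c (dot x (Y *m x)) (dot x (Y *m w))
        (dot w (Y *m x)) (dot w (Y *m w)))|
      <= b * Re (q c 1%:C (dot x w) (dot w x) 1%:C).
    by have := Yb (x + c *: w); rewrite nE dot_add_scale.
  move: Yac Ybc {nE}.
  move: (dot x w) (dot w x) => [? ?] [? ?].
  move: (dot w (Y *m w)) (dot x (Y *m x)) (dot x (Y *m w)) (dot w (Y *m x)).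
  move=> [? ?] [? ?] [? ?] [? ?] Yac Ybc.
  move: (Yac (1 +i* 0)) (Yac (-1 +i* 0)) (Ybc (0 +i* 1)) (Ybc (0 +i* -1)).
  move=> {Yac Ybc}; rewrite /q.
  rewrite !ler_norml => /andP[_ +] /andP[+ _] /andP[+ _] /andP[_ +] /=.
  rewrite !(cReD, cImD, cReM, cImM, cRe_conj, cIm_conj) /=; lra.
set z := dot y (Y *m x).
have [->|z0] := eqVneq z 0; first by rewrite cmod0 addr_ge0.
have cz0 : `|z| != 0 by rewrite normr_eq0.
(* The form is conjugate linear in its first argument, so the phase of y is
   that of z itself. *)
pose c := z / `|z|.
have c1 : cmod c = 1.
  by apply: complexI; rewrite cmodE /c normrM normfV normr_id divff.
have cy : enorm (c *: y) = 1.
  apply/eqP; rewrite -(eqrXn2 (n := 2)) ?sqrtr_ge0 // expr1n; apply/eqP.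
  apply: complexI; rewrite -dotxx dotZl dotZr dotxx y1 expr1n mulr1 mulrC -normCK.
  by rewrite -cmodE c1 expr1n.
suff -> : cmod z = Re (dot (c *: y) (Y *m x)) by apply: half.
rewrite dotZl -/z.
suff -> : Num.conj c * z = (cmod z)%:C by [].
rewrite cmodE /c rmorphM fmorphV /= mulrAC [_ * z]mulrC -normCK.
by rewrite (CrealP (normr_real z)) expr2 mulfK.
Qed.

Lemma dickson_mx_bound (R : realType) n (al be : R) (X : 'M[R[i]]_n.+1) k x y :
  0 <= be -> be < al -> elliptic_range (al + be) (al - be) X ->
  enorm x = 1 -> enorm y = 1 -> (0 < k)%N ->
  cmod (dot y (dickson_mx al be X k *m x)) <= 2 * al ^+ k.
Proof.
move=> be0 ba rX x1 y1 k0.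
have bk : be ^+ k < al ^+ k by rewrite ltrXn2r // -lt0n.
have bk0 : 0 <= be ^+ k by rewrite exprn_ge0.
have := @dot_polar _ _ (dickson_mx al be X k)
  (al ^+ k + be ^+ k) (al ^+ k - be ^+ k) x y.
rewrite (_ : _ + _ + _ = 2 * al ^+ k); last by ring.
by apply => // [||z|z]; [lra|lra|case: (dickson_mx_range be0 ba rX z k0)..].
Qed.

(** * Powers of a Hessenberg matrix *)

Lemma enorm_delta (R : realType) n (i : 'I_n) : enorm (delta_mx i 0 : 'cV[R[i]]_n) = 1.
Proof.
rewrite /enorm (bigD1 i) //= big1 => [|j ji]; last first.
  by rewrite mxE (negPf ji) cmod_nat expr0n.
by rewrite mxE !eqxx addr0 cmod_nat expr1n sqrtr1.
Qed.

Lemma dot_delta (R : realType) n (Y : 'M[R[i]]_n) i j :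
  dot (delta_mx i 0) (Y *m delta_mx j 0) = Y i j.
Proof.
rewrite /dot trmx_delta.
have -> : (delta_mx 0 i : 'rV[R[i]]_n) ^ Num.conj = delta_mx 0 i.
  by apply/matrixP => a b; rewrite !mxE rmorph_nat.
by rewrite -rowE -colE !mxE.
Qed.

Section PowerBound.
Variables (R : realType) (n : nat) (al be : R) (X : 'M[R[i]]_n.+1).
Local Notation D := (dickson_mx al be X).

Lemma dickson_mx0 : D 0 = 2%:R.
Proof. by rewrite /dickson_mx /= rmorph_nat. Qed.

Lemma dickson_mx1 : D 1 = X.
Proof. by rewrite /dickson_mx /= horner_mx_X. Qed.

Lemma dickson_mxSS k : D k.+2 = X * D k.+1 - (al * be)%:C *: D k.
Proof.
by rewrite /dickson_mx dicksonSS rmorphB rmorphM /= horner_mxZ horner_mx_X rmorphM.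
Qed.

(** D_k(X) is a polynomial of degree k in X, and each multiplication by a
    Hessenberg matrix moves the support of the first column down by at most
    one row. *)
Lemma dickson_mx_hessenberg k (i : 'I_n.+1) :
  upper_hessenberg X -> (k < i)%N -> D k i ord0 = 0.
Proof.
move=> hX; elim: k {-2}k (leqnn k) i => [|p IH] [|[|k]] // kp i ki.
- by rewrite dickson_mx0 mulmxnE mxE -val_eqE /= gtn_eqF // mul0rn.
- by rewrite dickson_mx0 mulmxnE mxE -val_eqE /= gtn_eqF // mul0rn.
- by rewrite dickson_mx1 hX.
have Dk : D k i ord0 = 0 by apply: IH; [exact: ltnW | exact: ltnW (ltnW ki)].
rewrite dickson_mxSS 2!mxE [X in _ + X]mxE mxE Dk mulr0 subr0.
apply: big1 => j _; have [ij|ij] := ltnP j.+1 i; first by rewrite hX ?mul0r.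
rewrite [X in _ * X]IH ?mulr0 //.
by rewrite -ltnS (leq_trans ki).
Qed.

Hypotheses (be0 : 0 <= be) (albe : be < al).
Hypothesis rangeX : elliptic_range (al + be) (al - be) X.
Hypothesis hessX : upper_hessenberg X.
Hypothesis n0 : (0 < n)%N.
Variable tau : R.
Hypothesis tau1 : 1 <= tau.

Let al0 : 0 < al := le_lt_trans be0 albe.
Let tau0 : 0 < tau := lt_le_trans ltr01 tau1.

(** Put U = al tau and W = be / tau. Induction on p: the relation
    X D_(k+1) = D_(k+2) + al be D_k is matched exactly by
    (U + W) (U^(k+1) + W^(k+1)) = U^(k+2) + W^(k+2) + U W (U^k + W^k), because
    U W = al be. For p = 0 the entry is 0 when k < n, and otherwise at most
    2 al^k <= 2 tau^-n U^k. *)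
Lemma power_dickson_bound p k :
  cmod ((X ^+ p * D k) ord_max ord0) <=
  2 / tau ^+ n * (al * tau + be / tau) ^+ p * ((al * tau) ^+ k + (be / tau) ^+ k).
Proof.
set K := 2 / tau ^+ n; set S := al * tau + be / tau.
have K0 : 0 <= K by rewrite divr_ge0 // exprn_ge0 // ltW.
have U0 : 0 <= al * tau by rewrite mulr_ge0 // ltW.
have W0 : 0 <= be / tau by rewrite divr_ge0 // ltW.
have S0 : 0 <= S by rewrite addr_ge0.
have UW : al * tau * (be / tau) = al * be by field; rewrite gt_eqF.
elim: p k => [|p IH] k.
  rewrite !expr0 mul1r mulr1.
  have [kn|nk] := ltnP k n.
    rewrite dickson_mx_hessenberg // cmod0.
    by rewrite mulr_ge0 // addr_ge0 // exprn_ge0.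
  rewrite -dot_delta.
  apply: le_trans (dickson_mx_bound be0 albe rangeX _ _ _) _; rewrite ?enorm_delta //.
    exact: leq_trans nk.
  apply: (@le_trans _ _ (K * (al * tau) ^+ k)); last first.
    by rewrite ler_wpM2l // lerDl exprn_ge0.
  rewrite /K exprMn -mulrA ler_wpM2l // mulrCA ler_peMr ?exprn_ge0 ?(ltW al0) //.
  by rewrite mulrC ler_pdivlMr ?exprn_gt0 // mul1r ler_weXn2l.
case: k => [|k].
  have -> : X ^+ p.+1 * D 0 = X ^+ p * D 1 *+ 2.
    by rewrite dickson_mx0 dickson_mx1 exprSr mulr_natr.
  rewrite mulmxnE mulr2n; apply: le_trans (cmodD _ _) _.
  apply: le_trans (lerD (IH 1%N) (IH 1%N)) _.
  rewrite !expr1 !expr0 -/S exprS; lra.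
have -> : X ^+ p.+1 * D k.+1 = X ^+ p * D k.+2 + (al * be)%:C *: (X ^+ p * D k).
  by rewrite dickson_mxSS mulrBr -scalerAr subrK exprSr mulrA.
rewrite mxE [X in _ + X]mxE; apply: le_trans (cmodD _ _) _.
have ab0 : 0 <= al * be by rewrite mulr_ge0 // ltW.
rewrite cmodM cmod_real ger0_norm //.
apply: le_trans (lerD (IH k.+2) (ler_wpM2l ab0 (IH k))) _.
rewrite -UW !exprS /S; set U := al * tau; set W := be / tau; lra.
Qed.

Lemma power_corner_bound p :
  cmod ((X ^+ p) ord_max ord0) <= 2 / tau ^+ n * (al * tau + be / tau) ^+ p.
Proof.
have := power_dickson_bound p 0; rewrite dickson_mx0 !expr0 mulr_natr mulmxnE.
by rewrite -[X in cmod X]mulr_natr cmodM cmod_nat; lra.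
Qed.

End PowerBound.

(** * Exponential series and their products *)

Lemma cauchy_triangle (K : comNzRingType) (a b : nat -> K) N :
  \sum_(n < N) \sum_(k < n.+1) a (n - k)%N * b k =
  \sum_(k < N) (\sum_(j < N - k) a j) * b k.
Proof.
elim: N => [|N IH]; first by rewrite !big_ord0.
rewrite big_ord_recr /= IH [RHS]big_ord_recr big_ord_recr /= addrA; congr (_ + _).
  rewrite -big_split /=; apply: eq_bigr => k _.
  by rewrite subSn 1?ltnW // big_ord_recr /= mulrDl.
by rewrite subnn subSnn big_ord1.
Qed.

Lemma sum_ord_split (V : zmodType) (a : nat -> V) (N k : nat) : (k <= N)%N ->
  \sum_(j < N) a j - \sum_(j < N - k) a j = \sum_(N - k <= j < N) a j.
Proof.
move=> kN; rewrite -(big_mkord predT a) -(big_mkord predT a).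
rewrite (big_cat_nat _ (leq_subr k N)) //=. by rewrite addrAC subrr add0r.
Qed.

(** The difference is the sum of the terms a_j b_k with j, k < N and j + k >= N,
    so it is dominated by the same difference for the majorants. *)
Lemma cauchy_error (R : realType) (a b : nat -> R[i]) (a' b' : nat -> R) N :
  (forall j, cmod (a j) <= a' j) -> (forall k, cmod (b k) <= b' k) ->
  cmod (\sum_(n < N) \sum_(k < n.+1) a (n - k)%N * b k -
        (\sum_(j < N) a j) * \sum_(k < N) b k) <=
  (\sum_(j < N) a' j) * (\sum_(k < N) b' k) -
    \sum_(n < N) \sum_(k < n.+1) a' (n - k)%N * b' k.
Proof.
move=> aa bb; rewrite !cauchy_triangle !big_distrr -!sumrB /=.
apply: le_trans (cmod_sum _ _ _) _; apply: ler_sum => k _.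
rewrite -[X in cmod X]opprB -!mulrBl cmodN cmodM !sum_ord_split 1?ltnW //.
apply: ler_pM => //; rewrite ?cmod_ge0 //.
by apply: le_trans (cmod_sum _ _ _) _; apply: ler_sum.
Qed.

Lemma exp_binomial (F : numFieldType) (z : F) (x : nat -> F) n :
  \sum_(k < n.+1) (z ^+ (n - k) / (n - k)`!%:R) * (x k / k`!%:R) =
  (\sum_(k < n.+1) z ^+ (n - k) * x k *+ 'C(n, k)) / n`!%:R.
Proof.
rewrite mulr_suml; apply: eq_bigr => -[k /= kn] _.
have fact0 j : j`!%:R != 0 :> F by rewrite pnatr_eq0 -lt0n fact_gt0.
rewrite -mulr_natr -(bin_fact (kn : (k <= n)%N)) !natrM; field.
by rewrite !fact0 pnatr_eq0 -lt0n bin_gt0 -ltnS kn.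
Qed.

Section ExponentialSeries.
Variable R : realType.
Implicit Types (z : R[i]) (x : nat -> R[i]) (y K S : R).

Definition exp_sum (F : numFieldType) (x : nat -> F) (N : nat) : F :=
  \sum_(k < N) x k / k`!%:R.

Lemma cvg_exp_sum y : (exp_sum (@GRing.exp _ y) @ \oo --> expR y)%classic.
Proof.
have -> : exp_sum (@GRing.exp _ y) = series (exp_coeff y).
  by apply/funext => N; rewrite /exp_sum /series /= big_mkord.
exact: is_cvg_series_exp_coeff.
Qed.

Lemma exp_sum_real y N :
  exp_sum (@GRing.exp _ y%:C) N = (exp_sum (@GRing.exp _ y) N)%:C.
Proof.
rewrite /exp_sum rmorph_sum; apply: eq_bigr => k _.
by rewrite /= fmorph_div /= rmorphXn rmorph_nat.
Qed.

Lemma exp_sum_le y N : 0 <= y -> exp_sum (@GRing.exp _ y) N <= expR y.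
Proof.
move=> y0; rewrite -(cvg_lim (@Rhausdorff R) (@cvg_exp_sum y)).
apply: nondecreasing_cvgn_le; last by apply: cvgP (@cvg_exp_sum y).
apply/nondecreasing_seqP => k; rewrite /exp_sum big_ord_recr lerDl /=.
by rewrite divr_ge0 ?exprn_ge0 // ler0n.
Qed.

(** The binomial expansion of (z + X)^n, with [x k] in place of X^k. *)
Definition conv_power z x n : R[i] := \sum_(k < n.+1) z ^+ (n - k) * x k *+ 'C(n, k).

(** By [cauchy_error] the error is at most K times the error for the real
    exponentials of |z| and S, which tends to 0 since
    expR (|z| + S) = expR |z| * expR S. *)
Lemma exp_sum_conv_error z x K S : (forall k, cmod (x k) <= K * S ^+ k) ->
  exists2 d : nat -> R, (d @ \oo --> 0)%classic &
    forall N, cmod (exp_sum (conv_power z x) N -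
                    exp_sum (@GRing.exp _ z) N * exp_sum x N) <= d N.
Proof.
move=> xS.
exists (fun N => K * (exp_sum (@GRing.exp _ (cmod z)) N * exp_sum (@GRing.exp _ S) N -
                       exp_sum (@GRing.exp _ (cmod z + S)) N)).
  rewrite -[X in (_ --> X)%classic](mulr0 K) -(subrr (expR (cmod z + S))) {1}expRD.
  by apply: cvgMr; apply: cvgB; [apply: cvgM|]; exact: cvg_exp_sum.
move=> N.
have := @cauchy_error R (fun j => z ^+ j / j`!%:R) (fun k => x k / k`!%:R)
  (fun j => cmod z ^+ j / j`!%:R) (fun k => K * (S ^+ k / k`!%:R)) N.
have -> : \sum_(n < N) \sum_(k < n.+1) z ^+ (n - k) / (n - k)`!%:R * (x k / k`!%:R)
    = exp_sum (conv_power z x) N.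
  by apply: eq_bigr => n _; rewrite exp_binomial.
have -> : \sum_(n < N) \sum_(k < n.+1)
   cmod z ^+ (n - k) / (n - k)`!%:R * (K * (S ^+ k / k`!%:R))
    = K * exp_sum (@GRing.exp _ (cmod z + S)) N.
  rewrite /exp_sum big_distrr; apply: eq_bigr => n _ /=.
  under eq_bigr do rewrite mulrCA.
  by rewrite -big_distrr exp_binomial exprDn.
rewrite -big_distrr /= mulrCA -mulrBr; apply.
- by move=> j; rewrite cmodM cmodV cmod_nat cmodX.
- move=> k; rewrite cmodM cmodV cmod_nat mulrA.
  by rewrite ler_wpM2r // invr_ge0 ler0n.
Qed.

(** This is |e^z| = e^(Re z), obtained from
    |e^z|^2 = e^z e^(conj z) = e^(2 Re z) through the product estimate. *)
Lemma cmod_exp_sum z : exists2 e : nat -> R,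
  (e @ \oo --> expR (Re z))%classic &
  forall N, cmod (exp_sum (@GRing.exp _ z) N) <= e N.
Proof.
have zS k : cmod (Num.conj z ^+ k) <= 1 * cmod z ^+ k.
  rewrite mul1r -lecR rmorphXn /= !cmodE normrX norm_conjC //.
have [d d0 dP] := exp_sum_conv_error z zS.
exists (fun N => Num.sqrt (exp_sum (@GRing.exp _ (Re z + Re z)) N + d N)).
  have -> : expR (Re z) = Num.sqrt (expR (Re z + Re z) + 0).
    by rewrite addr0 expRD -expr2 sqrtr_sqr ger0_norm // expR_ge0.
  apply: (continuous_cvg _ (@sqrt_continuous R _)).
  by apply: cvgD => //; exact: cvg_exp_sum.
move=> N; set E := exp_sum _ N.
rewrite -[leLHS]ger0_norm ?cmod_ge0 // -sqrtr_sqr ler_wsqrtr //.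
have conjE : exp_sum (@GRing.exp _ (Num.conj z)) N = Num.conj E.
  rewrite /E /exp_sum rmorph_sum; apply: eq_bigr => k _.
  by rewrite /= fmorph_div /= rmorphXn /= conjC_nat.
have := dP N; rewrite conjE -normCK -cmodE.
have -> : conv_power z (@GRing.exp _ (Num.conj z)) = GRing.exp ((Re z + Re z)%:C).
  apply/funext => n; rewrite /conv_power -exprDn; congr (_ ^+ _).
  by case: z {zS d d0 dP E conjE} => u v; apply/eqP; rewrite eq_complex /= subrr !eqxx.
rewrite exp_sum_real -rmorphXn -rmorphB cmod_real ler_norml => /andP[+ _].
by rewrite lerNl opprB lerBlDl.
Qed.

Lemma exp_sum_conv_bound z x K S : 0 <= K -> 0 <= S ->
  (forall k, cmod (x k) <= K * S ^+ k) ->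
  exists2 u : nat -> R, (u @ \oo --> expR (Re z) * (K * expR S))%classic &
    forall N, cmod (exp_sum (conv_power z x) N) <= u N.
Proof.
move=> K0 S0 xS; have [d d0 dP] := exp_sum_conv_error z xS.
have [e e0 eP] := cmod_exp_sum z.
exists (fun N => e N * (K * expR S) + d N).
  rewrite -[X in (_ --> X)%classic]addr0; apply: cvgD => //; apply: cvgMl => //.
move=> N; set P := exp_sum (@GRing.exp _ z) N * exp_sum x N.
rewrite -[X in cmod X](subrK P) addrC.
apply: le_trans (cmodD _ _) _; apply: lerD => //.
rewrite cmodM; apply: ler_pM; rewrite ?cmod_ge0 //.
apply: le_trans (cmod_sum _ _ _) _.
apply: (@le_trans _ _ (K * exp_sum (@GRing.exp _ S) N)); last first.
  by rewrite ler_wpM2l // exp_sum_le.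
rewrite /exp_sum big_distrr; apply: ler_sum => k _ /=.
by rewrite cmodM cmodV cmod_nat mulrA ler_wpM2r // invr_ge0 ler0n.
Qed.

End ExponentialSeries.

(** * Convergence of the matrix exponential *)

Local Open Scope classical_set_scope.

Section MatrixExponential.
Variables (R : realType).
Local Notation C := R[i].

Lemma is_cvg_exp_sum (r : nat -> R) S : (forall k, `|r k| <= S ^+ k) ->
  cvgn (exp_sum r).
Proof.
move=> rS; have S0 : 0 <= S by apply: le_trans (rS 1%N); rewrite normr_ge0.
have -> : exp_sum r = series (fun k => r k / k`!%:R).
  by apply/funext => N; rewrite /exp_sum /series /= big_mkord.
apply: normed_cvg; apply: series_le_cvg (is_cvg_series_exp_coeff S) => [k|k|k] /=.
- exact: normr_ge0.
- exact: exp_coeff_ge0.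
by rewrite normrM normfV [X in _ / X]ger0_norm ?ler0n // ler_wpM2r ?invr_ge0.
Qed.

Lemma cmod_le_ReIm (z : C) : cmod z <= `|Re z| + `|Im z|.
Proof.
rewrite -(ler_pXn2r (n := 2)) ?nnegrE ?cmod_ge0 ?addr_ge0 //.
rewrite sqr_cmod -(real_normK (num_real (Re z))) -(real_normK (num_real (Im z))).
rewrite sqrrD lerD2r lerDl mulrn_wge0 // mulr_ge0 //.
Qed.

Lemma Re_le_cmod (z : C) : `|Re z| <= cmod z.
Proof.
rewrite -(ler_pXn2r (n := 2)) ?nnegrE ?cmod_ge0 // sqr_cmod.
by rewrite real_normK ?num_real // lerDl sqr_ge0.
Qed.

Lemma Im_le_cmod (z : C) : `|Im z| <= cmod z.
Proof.
rewrite -(ler_pXn2r (n := 2)) ?nnegrE ?cmod_ge0 // sqr_cmod.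
by rewrite real_normK ?num_real // lerDr sqr_ge0.
Qed.

Lemma cvg_complex_exp_sum (x : nat -> C) S : (forall k, cmod (x k) <= S ^+ k) ->
  exists L : C, (fun N => cmod (L - exp_sum x N)) @ \oo --> 0.
Proof.
move=> xS.
have /cvg_ex[u uP] : cvgn (exp_sum (fun k => Re (x k))).
  by apply: (@is_cvg_exp_sum _ S) => k; exact: le_trans (Re_le_cmod _) (xS k).
have /cvg_ex[v vP] : cvgn (exp_sum (fun k => Im (x k))).
  by apply: (@is_cvg_exp_sum _ S) => k; exact: le_trans (Im_le_cmod _) (xS k).
exists (u +i* v).
have cuv : (fun N => `|u - exp_sum (fun k => Re (x k)) N| +
                     `|v - exp_sum (fun k => Im (x k)) N|) @ \oo --> 0.
  rewrite -[X in _ --> X](addr0 0); apply: cvgD; rewrite -[X in _ --> X](normr0 R);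
    apply: cvg_norm; rewrite -[X in _ --> X](subrr u) -?[X in _ --> X](subrr v).
    by rewrite (subrr u) -(subrr u); apply: cvgB => //; exact: cvg_cst.
  by rewrite (subrr u) -(subrr v); apply: cvgB => //; exact: cvg_cst.
apply: squeeze_cvgr cuv; last exact: cvg_cst.
near=> N; rewrite cmod_ge0 /=; apply: le_trans (cmod_le_ReIm _) _.
have fE k : x k / k`!%:R = (Re (x k) / k`!%:R) +i* (Im (x k) / k`!%:R).
  have -> : k`!%:R = (k`!%:R)%:C :> C by rewrite rmorph_nat.
  rewrite -fmorphV; case: (x k) => p q; apply/eqP.
  by rewrite eq_complex /= !mulr0 subr0 add0r mulrC !eqxx.
rewrite cReD cImD cReN cImN /exp_sum cRe_sum cIm_sum /=.
by rewrite lerD // le_eqVlt; apply/orP; left; apply/eqP; congr `| _ - _ |;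
  apply: eq_bigr => k _; rewrite fE.
Unshelve. all: by end_near. Qed.

Section Matrix.
Variable n : nat.
Implicit Type M : 'M[C]_n.+1.

Lemma cmod_power_entry M k i j :
  cmod ((M ^+ k) i j) <= (\sum_p \sum_q cmod (M p q)) ^+ k.
Proof.
set S := \sum_p _.
have S0 : 0 <= S by apply: sumr_ge0 => p _; apply: sumr_ge0 => q _; exact: cmod_ge0.
elim: k i j => [|k IH] i j.
  rewrite !expr0 mxE cmod_nat; by case: (i == j).
rewrite !exprS mxE; apply: le_trans (cmod_sum _ _ _) _.
apply: (@le_trans _ _ (\sum_q cmod (M i q) * S ^+ k)).
  by apply: ler_sum => q _; rewrite cmodM ler_wpM2l ?cmod_ge0.
rewrite -mulr_suml ler_wpM2r ?exprn_ge0 //.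
rewrite /S [leRHS](bigD1 i) //= lerDl; apply: sumr_ge0 => p _.
by apply: sumr_ge0 => q _; exact: cmod_ge0.
Qed.

(** The entries of the partial sums converge, so the partial sums converge as
    matrices and [expmx], defined as their limit, is approached entrywise. *)
Lemma cvg_expmx_entry M i j :
  (fun N => cmod (expmx M i j - exp_sum (fun k => (M ^+ k) i j) N)) @ \oo --> 0.
Proof.
pose T N := \sum_(0 <= k < N) (k`!%:R^-1 : C) *: M ^+ k : 'M[C^o]_n.+1.
have TE N p q : T N p q = exp_sum (fun k => (M ^+ k) p q) N.
  rewrite /T /exp_sum summxE big_mkord; apply: eq_bigr => k _.
  by rewrite mxE mulrC.
have Texp : T @ \oo --> (expmx M : 'M[C^o]_n.+1).
  have /choice[L LP] : forall pq : 'I_n.+1 * 'I_n.+1, exists l : C,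
      (fun N => cmod (l - exp_sum (fun k => (M ^+ k) pq.1 pq.2) N)) @ \oo --> 0.
    by move=> [p q]; apply: cvg_complex_exp_sum => k; exact: cmod_power_entry.
  suff : cvgn T by [].
  apply/cvg_ex; exists (\matrix_(p, q) L (p, q)).
  apply/cvg_ballP => e e0.
  have er : e = (Re e)%:C by rewrite RRe_real ?gtr0_real.
  have e0' : 0 < Re e by move: e0; rewrite er ltcR.
  have : \forall N \near \oo, forall pq : 'I_n.+1 * 'I_n.+1,
      cmod (L pq - exp_sum (fun k => (M ^+ k) pq.1 pq.2) N) < Re e.
    apply: filter_forall => pq.
    have /cvgr0Pnorm_lt/(_ _ e0') := LP pq; apply: filterS => N.
    by rewrite ger0_norm ?cmod_ge0.
  apply: filterS => N NP; split => // p q.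
  rewrite -ball_normE /= mxE TE er -cmodE ltcR.
  exact: NP (p, q).
apply/cvgr0Pnorm_lt => e e0.
have e0C : 0 < e%:C :> C by rewrite ltcR.
move/cvg_ballP: Texp => /(_ _ e0C); apply: filterS => N [_ /(_ i j)].
by rewrite -ball_normE /= TE -cmodE ltcR ger0_norm ?cmod_ge0.
Qed.

End Matrix.
End MatrixExponential.

(** * The residual bound *)

Section Compression.
Variables (R : realType) (n m : nat).
Local Notation C := R[i].

Lemma enorm_eq0 (x : 'cV[C]_n) : enorm x = 0 -> x = 0.
Proof.
move=> x0; have := congr1 (fun z => z ^+ 2) x0.
rewrite /enorm sqr_sqrtr; last by apply: sumr_ge0 => i _; exact: sqr_ge0.
rewrite expr0n => /eqP; rewrite psumr_eq0 => [/allP e|i _]; last exact: sqr_ge0.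
apply/matrixP => i j; rewrite ord1 mxE.
have := e i (mem_index_enum i); rewrite /= sqrf_eq0 => /eqP.
exact: Normc.eq0_normc.
Qed.

Lemma elliptic_range_of_field (A : 'M[C]_n) a b c :
  field_of_values A `<=` ellipse_region a b c -> elliptic_range a b (A - c%:M).
Proof.
move=> AE x.
have [/enorm_eq0 ->|x0] := eqVneq (enorm x) 0.
  by rewrite mulmx0 /dot mulmx0 mxE /= !mul0r expr0n addr0.
pose r := enorm x; pose y := (r^-1)%:C *: x.
have r0 : 0 < r by rewrite lt0r x0 sqrtr_ge0.
have rV : Num.conj (r^-1)%:C = (r^-1)%:C by rewrite conj_conjc conjc_real.
have y1 : enorm y = 1.
  apply/eqP; rewrite -(eqrXn2 (n := 2)) ?sqrtr_ge0 // expr1n; apply/eqP.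
  apply: complexI; rewrite -dotxx dotZl dotZr dotxx rV -/r -!rmorphM /=.
  by congr (_%:C); field; rewrite gt_eqF.
have /AE : field_of_values A (dot y (A *m y)).
  by exists y; split => //; rewrite /dot mulmxA.
rewrite /ellipse_region /= -scalemxAr dotZl dotZr rV.
rewrite mulmxBl mul_scalar_mx -[- (c *: x)]scaleNr dotDr dotZr dotxx -/r.
move: (dot x (A *m x)) => [p q]; case: c {AE} => c d /=.
rewrite !mul0r !subr0 !addr0 !mulr0 => h.
have r4 : 0 <= r ^+ 4 by rewrite exprn_ge0 // ltW.
have {h} := ler_wpM2l r4 h; rewrite mulr1 -exprM; apply: le_trans.
rewrite le_eqVlt; apply/orP; left; apply/eqP.
rewrite mulrDr.
have sq (u v e : R) : r ^+ 4 * ((r^-1 * (r^-1 * u) - v) / e) ^+ 2 =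
    ((u - v * r ^+ 2) / e) ^+ 2.
  rewrite !exprMn [RHS]mulrC [LHS]mulrA mulrC; congr (_ * _).
  by field; rewrite gt_eqF.
by rewrite !sq; congr ((_ / _) ^+ 2 + (_ / _) ^+ 2); ring.
Qed.

Lemma enorm_isometry (V : 'M[C]_(n, m)) (x : 'cV[C]_m) :
  orthonormal_cols V -> enorm (V *m x) = enorm x.
Proof.
move=> V1; apply/eqP; rewrite -(eqrXn2 (n := 2)) ?sqrtr_ge0 //; apply/eqP.
apply: complexI; rewrite -!dotxx /dot trmx_mul map_mxM mulmxA -[_ *m _ *m V]mulmxA.
by rewrite V1 mulmx1.
Qed.

Lemma field_of_values_compression (A : 'M[C]_n) (V : 'M[C]_(n, m)) :
  orthonormal_cols V ->
  field_of_values (V ^t* *m A *m V) `<=` field_of_values A.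
Proof.
move=> V1 z [x [x1 ->]]; exists (V *m x).
by rewrite enorm_isometry // x1; split=> //; rewrite trmx_mul map_mxM !mulmxA.
Qed.

Lemma orthonormal_colsl (p : nat) (V : 'M[C]_(n, m)) (W : 'M[C]_(n, p)) :
  orthonormal_cols (row_mx V W) -> orthonormal_cols V.
Proof.
rewrite /orthonormal_cols tr_row_mx map_col_mx mul_col_row scalar_mx_block.
by move=> /eq_block_mx[].
Qed.

End Compression.

Section Corner.
Variables (R : realType) (n : nat).
Local Notation C := R[i].

Lemma residual_corner (H : 'M[C]_n.+1) (h : R) : 0 <= h ->
  residual H h = h * cmod (expmx (- H) ord_max ord0).
Proof.
move=> h0; rewrite /residual cmodM cmod_real ger0_norm //; congr (_ * cmod _).
have -> : (ebasis R n.+1 n.+1)^T = delta_mx ord0 ord_max.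
  by apply/matrixP => i j; rewrite !mxE ord1 eqSS -val_eqE.
have -> : ebasis R n.+1 1 = delta_mx ord0 ord0.
  by apply/matrixP => i j; rewrite !mxE ord1 eqSS -val_eqE andbT.
by rewrite -rowE -colE !mxE.
Qed.

(** The binomial formula for - c - X expresses the partial sums of the entry as
    products of an exponential sum of - c and one of the numbers
    (- X)^k, up to a vanishing error. *)
Lemma exp_corner_bound (X : 'M[C]_n.+1) (c : C) K S : 0 <= K -> 0 <= S ->
  (forall k, cmod ((X ^+ k) ord_max ord0) <= K * S ^+ k) ->
  cmod (expmx (- (X + c%:M)) ord_max ord0) <= expR (- Re c) * (K * expR S).
Proof.
move=> K0 S0 XS; set L := expmx _ _ _.
pose x k := ((- X) ^+ k) ord_max ord0.
have xS k : cmod (x k) <= K * S ^+ k.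
  by rewrite /x exprNn -signr_odd mulr_sign; case: odd; rewrite ?mxE ?cmodN.
have powE : (fun k => ((- (X + c%:M)) ^+ k) ord_max ord0) = conv_power (- c) x.
  apply/funext => k; rewrite opprD addrC exprDn_comm; last first.
    by rewrite -raddfN; exact: comm_scalar_mx.
  rewrite summxE; apply: eq_bigr => j _; rewrite mulmxnE; congr (_ *+ _).
  have -> : (- c%:M) ^+ (k - j) = ((- c) ^+ (k - j))%:M :> 'M[C]_n.+1.
    by rewrite -raddfN /= rmorphXn.
  by rewrite -[_%:M * _]/(_%:M *m _) mul_scalar_mx mxE.
have [u uP uB] := exp_sum_conv_bound (- c) K0 S0 xS.
have := cvg_expmx_entry (- (X + c%:M)) ord_max ord0.
rewrite powE -/L => /(cvgD uP); rewrite addr0 cReN.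
move=> cu; apply: (ler_cvg_to (cvg_cst (cmod L)) cu).
near=> N; rewrite /= addrC -{1}(subrK (exp_sum (conv_power (- c) x) N) L).
by apply: le_trans (cmodD _ _) _; rewrite lerD2l.
Unshelve. all: by end_near. Qed.

End Corner.

Theorem mainTheorem2 (R : realType) (n m : nat)
    (A : 'M[R[i]]_n) (v : 'cV[R[i]]_n)
    (V : 'M[R[i]]_(n, m)) (w : 'cV[R[i]]_n) (H : 'M[R[i]]_m) (h : R)
    (a b c1 c2 : R) :
  enorm v = 1 ->
  arnoldi A v V w H h ->
  0 < b -> b <= a ->
  field_of_values A `<=` ellipse_region a b (c1 +i* c2) ->
  b + 1 < m%:R ->
  `|residual H h| <=
    h * (2 * expR (- c1) * pfun a b m%:R *
      (expR (qfun a b (m%:R - 1)) * (a + b) /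
       (m%:R - 1 + Num.sqrt ((m%:R - 1) ^+ 2 + (a ^+ 2 - b ^+ 2)))) ^+ (m - 1)).
Proof.
move=> _ arn b0 ba AE bm.
have h0 := arnoldi_h_ge0 arn.
have hessH := arnoldi_hessenberg arn.
have HE := arnoldi_compression arn.
have V1 := orthonormal_colsl (arnoldi_orthonormal arn).
case: m V H {arn} V1 hessH HE bm => [|m] V H V1 hessH HE bm.
  by exfalso; lra.
have HAE : field_of_values H `<=` ellipse_region a b (c1 +i* c2).
  by rewrite HE => z /(field_of_values_compression V1)/AE.
have := elliptic_range_of_field HAE.
set c := c1 +i* c2; set X := H - c%:M => rangeX.
have hessX : upper_hessenberg X.
  move=> i j ij; rewrite /X !mxE hessH // add0r.
  by rewrite -val_eqE gtn_eqF ?oppr0 // (ltn_trans _ ij).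
set M : R := m%:R.
have mE : m.+1%:R - 1 = M by rewrite -natr1 addrK.
have bM : b < M by rewrite -mE; lra.
have m0 : (0 < m)%N by rewrite -(ltr0n R) -/M; lra.
rewrite /pfun /qfun /sqrt_term mE subn1 /=.
set s := Num.sqrt _.
have ab2 : 0 <= a ^+ 2 - b ^+ 2 by rewrite subr_ge0 ler_pXn2r // nnegrE; lra.
have s2 : s ^+ 2 = M ^+ 2 + (a ^+ 2 - b ^+ 2).
  by rewrite sqr_sqrtr // addr_ge0 ?sqr_ge0.
have s0 : 0 <= s by exact: sqrtr_ge0.
have as_ : a < s.
  by rewrite -(ltr_pXn2r (n := 2)) ?nnegrE ?s2 //; nra.
have M0 : 0 < M by lra.
have p0 : 0 < M + s - (a + b) by lra.
have ab0 : 0 < a + b by lra.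
(* tau is the minimizer of tau^-M e^(al tau + be / tau). *)
pose tau := (M + s) / (a + b).
pose al := (a + b) / 2; pose be := (a - b) / 2.
have tau1 : 1 <= tau by rewrite /tau ler_pdivlMr // mul1r; lra.
have tau0 : 0 < tau by lra.
have be0 : 0 <= be by rewrite /be; lra.
have albe : be < al by rewrite /be /al; lra.
have rangeX' : elliptic_range (al + be) (al - be) X.
  have -> : al + be = a by rewrite /al /be; field.
  by have -> : al - be = b by rewrite /al /be; field.
have S_eq : al * tau + be / tau = s.
  have : s ^+ 2 - M ^+ 2 = a ^+ 2 - b ^+ 2 by rewrite s2; ring.
  rewrite /al /be /tau => e.
  have -> : (a - b) / 2 / ((M + s) / (a + b)) = (a ^+ 2 - b ^+ 2) / (M + s) / 2.
    by field; rewrite !gt_eqF //; lra.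
  by rewrite -e; field; rewrite !gt_eqF //; lra.
have K0 : 0 <= 2 / tau ^+ m by rewrite divr_ge0 // exprn_ge0 // ltW.
have key : cmod (expmx (- H) ord_max ord0) <= expR (- c1) * (2 / tau ^+ m * expR s).
  rewrite -(subrK c%:M H) -/X -[c1]/(Re c); apply: exp_corner_bound => // k.
  by rewrite -S_eq; apply: power_corner_bound.
rewrite residual_corner // ger0_norm ?mulr_ge0 ?cmod_ge0 //.
rewrite ler_wpM2l //; apply: le_trans key _.
have q_eq : (1 + (a ^+ 2 - b ^+ 2) / (M ^+ 2 + M * s)) * M = s.
  have -> : a ^+ 2 - b ^+ 2 = s ^+ 2 - M ^+ 2 by rewrite s2; ring.
  by field; rewrite !gt_eqF //; nra.
set q := 1 + _ in q_eq *.
have -> : (expR q * (a + b) / (M + s)) ^+ m = expR s / tau ^+ m.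
  have -> : expR q * (a + b) / (M + s) = expR q / tau.
    by rewrite /tau; field; rewrite !gt_eqF //; lra.
  by rewrite exprMn exprVn -expRM_natr -/M q_eq.
set T := expR s / tau ^+ m.
have T0 : 0 <= T by rewrite divr_ge0 ?expR_ge0 ?exprn_ge0 // ltW.
have -> : expR (- c1) * (2 / tau ^+ m * expR s) = 2 * expR (- c1) * 1 * T.
  by rewrite /T; ring.
rewrite ler_wpM2r // ler_wpM2l ?mulr_ge0 ?expR_ge0 //.
by rewrite ler_pdivlMr // mul1r; lra.
Qed.
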